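(* Let $A_q=(\mathcal P,\mathcal L)$ be a finite affine plane of order $q$, and let $S$ and $T$ be integer multisets of points in $A_q$ with multiplicity functions $\mu_S,\mu_T:\mathcal P\to\mathbb Z$. Suppose that there is no direction from which both $S$ and $T$ are inequidistributed. Then $$\sum_{P\in\mathcal P}\mu_S(P)\mu_T(P)=\frac{|S||T|}{q^2}.$$ If $S$ and $T$ are ordinary sets, this formula simplifies to $|S\cap T|=|S||T|/q^2$. In particular, if $S$ and $T$ are disjoint point sets of size $q$ in $A_q$, then there is a direction determined by both of them.
   Context: An affine plane of order $q$ (not necessarily Desarguesian) is written $A_q=(\mathcal P,\mathcal L)$ with point set $\mathcal P$ ($|\mathcal P|=q^2$) and line set $\mathcal L$, each line being a set of $q$ points. A direction is a parallel class of lines (equivalently, a point of the line at infinity of the projective completion); there are $q+1$ directions, and a line has direction $(d)$ if it belongs to that parallel class. An integer multiset $S$ of points is given by a multiplicity function $\mu_S:\mathcal P\to\mathbb Z$ (negative values allowed); ordinary sets correspond to $\{0,1\}$-valued $\mu_S$. Put $|S|=\sum_{P\in\mathcal P}\mu_S(P)$ and, for a line $\ell$, $|S\cap\ell|=\sum_{P\in\ell}\mu_S(P)$. $S$ is equidistributed from direction $(d)$ if all lines with direction $(d)$ have the same value $|S\cap\ell|$ (necessarily $|S|/q$), and inequidistributed from $(d)$ otherwise. An ordinary set $S$ of points determines the direction $(d)$ if there are two distinct points $P,Q\in S$ such that the line $PQ$ has direction $(d)$. *)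

(* Defs.v *)
From mathcomp Require Import all_boot all_order all_algebra.
Set Implicit Arguments.
Unset Strict Implicit.
Unset Printing Implicit Defensive.

Import GRing.Theory Num.Theory.
Local Open Scope ring_scope.

(* Distinctness of the three points in [ap_nondeg] excludes the one-point
   structure without lines. Together with the other axioms, [ap_order] entails
   2 <= q, #|point| = q ^ 2 and the existence of exactly q + 1 directions. *)
Record affinePlane (q : nat) := AffinePlane {
  point : finType;
  lines : {set {set point}};
  ap_join : forall x y : point, x != y ->
    exists! l : {set point}, [/\ l \in lines, x \in l & y \in l];
  ap_playfair : forall (l : {set point}) (x : point),
    l \in lines -> x \notin l ->
    exists! m : {set point}, [/\ m \in lines, x \in m & [disjoint l & m]];
  ap_nondeg : exists x y z : point, uniq [:: x; y; z] /\
    forall l : {set point}, l \in lines -> ~~ ([set x; y; z] \subset l);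
  ap_order : forall l : {set point}, l \in lines -> #|l| = q
}.

Section Directions.

Variables (q : nat) (A : affinePlane q).
Implicit Types (l m : {set point A}) (d : {set {set point A}}).
Implicit Types (mu : point A -> int) (S : {set point A}).

Definition parallel l m : bool := (l == m) || [disjoint l & m].

Definition directions : {set {set {set point A}}} :=
  equivalence_partition parallel (lines A).

Definition msize mu : int := \sum_(x : point A) mu x.

Definition mcount mu l : int := \sum_(x in l) mu x.

Definition equidistributed mu d : bool :=
  [forall l in d, forall m in d, mcount mu l == mcount mu m].

Definition mult_of_set S : point A -> int := fun x => (x \in S)%:Z.

Definition determines S d : bool :=
  [exists x in S, exists y in S, (x != y) &&
    [exists l in d, (x \in l) && (y \in l)]].

End Directions.

(* Main.v *)
(** Count [\sum_l |S :&: l| * |T :&: l|] over all lines in two ways. Expanding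
    over pairs of points, two distinct points lie on one common line and a
    point lies on [q + 1] lines, which gives [q * \sum_x muS x * muT x + |S||T|].
    Grouping the lines by direction, a direction from which [S] or [T] is
    equidistributed contributes [|S||T| / q], which gives [(q + 1)|S||T| / q].
    For the last claim, a set of [q] points that does not determine a direction
    meets each of its [q] lines exactly once, so it is equidistributed from it. *)
Require Import Defs.
From mathcomp Require Import all_boot all_order all_algebra.
From mathcomp Require Import ring.
Set Implicit Arguments.
Unset Strict Implicit.
Unset Printing Implicit Defensive.

Import GRing.Theory Num.Theory.
Local Open Scope ring_scope.

Section AffinePlaneCounting.

Variables (q : nat) (A : affinePlane q).
Implicit Types (l m p : {set point A}) (d : {set {set point A}}).
Implicit Types (x y : point A) (mu : point A -> int) (S T : {set point A}).

(** * Parallelism and the partition of the lines into directions *)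

Lemma line_unique l m x y : l \in lines A -> m \in lines A -> x != y ->
  x \in l -> y \in l -> x \in m -> y \in m -> l = m.
Proof.
move=> lA mA neq_xy xl yl xm ym.
have [p [_ uniq_p]] := ap_join neq_xy.
by rewrite -(uniq_p l) // -(uniq_p m).
Qed.

Lemma parallel_sym l m : parallel l m = parallel m l.
Proof. by rewrite /parallel eq_sym disjoint_sym. Qed.

Lemma parallel_meet l m x : parallel l m -> x \in l -> x \in m -> l = m.
Proof.
by case/orP=> [/eqP // | dis_lm xl]; rewrite (disjointFr dis_lm xl).
Qed.

(** Suppose [l] and [p] meet in [x]. If [x] is on [m], both lines equal [m]; otherwise both are
    lines through [x] disjoint from [m], and the uniqueness in Playfair's axiom identifies them. *)
Lemma parallel_trans l m p : l \in lines A -> m \in lines A -> p \in lines A ->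
  parallel l m -> parallel m p -> parallel l p.
Proof.
move=> lA mA pA lm mp; have [//|] := boolP (parallel l p).
rewrite negb_or => /andP[neq_lp /pred0Pn[x /andP[/= xl xp]]].
have [xm|xm] := boolP (x \in m).
  by move: neq_lp; rewrite (parallel_meet lm xl xm) (parallel_meet mp xm xp) eqxx.
have [m' [_ uniq_m']] := ap_playfair mA xm.
have dis_lm : [disjoint m & l].
  by case/orP: lm => [/eqP eq_lm|]; [rewrite -eq_lm xl in xm | rewrite disjoint_sym].
have dis_mp : [disjoint m & p].
  by case/orP: mp => [/eqP eq_mp|//]; rewrite eq_mp xp in xm.
by move: neq_lp; rewrite -(uniq_m' l) // -(uniq_m' p) // eqxx.
Qed.

Lemma parallel_equiv : {in lines A & &, equivalence_rel (@parallel q A)}.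
Proof.
move=> l m p lA mA pA; split=> [|lm]; first by rewrite /parallel eqxx.
apply/idP/idP; last exact: parallel_trans.
by apply: parallel_trans; rewrite // parallel_sym.
Qed.

Lemma directions_partition : partition (directions A) (lines A).
Proof. exact: equivalence_partitionP parallel_equiv. Qed.

Lemma direction_lines d l : d \in directions A -> l \in d -> l \in lines A.
Proof.
move=> dA ld; rewrite -(cover_partition directions_partition).
by apply/bigcupP; exists d.
Qed.

Lemma direction_mem d l m : d \in directions A -> l \in d -> m \in lines A ->
  (m \in d) = parallel l m.
Proof.
move=> dA ld mA; have lA := direction_lines dA ld.
have tA : trivIset (directions A) by case/and3P: directions_partition.
by rewrite -(pblock_equivalence_partition parallel_equiv lA mA) (def_pblock tA dA ld).
Qed.

(** The lines [xy] and [xz] of a noncollinear triple share [x], so if parallel they would coincide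
    and contain the triple. This provides a transversal to any given direction. *)
Lemma two_lines_meet : exists2 l, l \in lines A & exists2 m, m \in lines A &
  ~~ parallel l m.
Proof.
have [x [y [z [/and3P[]]]]] := ap_nondeg A.
rewrite !inE negb_or => /andP[neq_xy neq_xz] _ _ nsub.
have [l [[lA xl yl] _]] := ap_join neq_xy.
have [m [[mA xm zm] _]] := ap_join neq_xz.
exists l => //; exists m => //; apply/negP => lm.
have eq_lm := parallel_meet lm xl xm; rewrite -eq_lm in zm.
case/negP: (nsub l lA); apply/subsetP=> w.
by rewrite !inE => /orP[/orP[]|] /eqP->.
Qed.

Lemma order_gt1 : (1 < q)%N.
Proof.
have [x [y [z [/and3P[]]]]] := ap_nondeg A.
rewrite !inE negb_or => /andP[neq_xy _] _ _ _.
have [l [[lA xl yl] _]] := ap_join neq_xy.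
rewrite -(ap_order lA); apply/card_gt1P; by exists x, y.
Qed.

Lemma line_nonempty l : l \in lines A -> l != set0.
Proof. by move=> lA; rewrite -card_gt0 (ap_order lA) ltnW ?order_gt1. Qed.

Lemma direction_nonempty d : d \in directions A -> exists l, l \in d.
Proof.
move=> dA; apply/set0Pn; apply: contraTneq dA => ->.
by case/and3P: directions_partition.
Qed.

(** Playfair's existence part puts a line of [d] through every point; distinct lines of [d] are
    disjoint by the definition of [parallel]. *)
Lemma direction_partition d : d \in directions A -> partition d [set: point A].
Proof.
move=> dA; have dl := direction_lines dA; apply/and3P; split.
- rewrite eqEsubset subsetT; apply/subsetP=> x _; apply/bigcupP.
  have [l ld] := direction_nonempty dA.
  have [xl|xl] := boolP (x \in l); first by exists l.
  have [m [[mA xm dis_lm] _]] := ap_playfair (dl _ ld) xl.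
  by exists m => //; rewrite (direction_mem dA ld mA) /parallel dis_lm orbT.
- apply/trivIsetP=> l m ld md neq_lm.
  have := direction_mem dA ld (dl _ md).
  by rewrite md /parallel (negPf neq_lm).
- by apply/negP=> /dl /line_nonempty; rewrite eqxx.
Qed.

(** * Line counts summed over one direction *)

Lemma sum_mcount d mu : d \in directions A ->
  \sum_(l in d) mcount mu l = msize mu.
Proof.
move=> dA; rewrite -(set_partition_big _ (direction_partition dA)).
by apply: eq_bigl => x; rewrite in_setT.
Qed.

Lemma mcountE mu l : mcount mu l = \sum_x (x \in l)%:Z * mu x.
Proof.
rewrite /mcount big_mkcond; apply: eq_bigr => x _.
by case: (x \in l); rewrite ?mul1r ?mul0r.
Qed.

Lemma mcount_set S l : mcount (mult_of_set S) l = #|S :&: l|%:Z.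
Proof.
rewrite mcountE -sum1_card -natz natr_sum [RHS]big_mkcond; apply: eq_bigr => x _.
by rewrite inE /mult_of_set; case: (x \in S); case: (x \in l).
Qed.

Lemma msize_set S : msize (mult_of_set S) = #|S|%:Z.
Proof.
rewrite /msize -sum1_card -natz natr_sum [RHS]big_mkcond; apply: eq_bigr => x _.
by rewrite /mult_of_set; case: (x \in S).
Qed.

Lemma mcount1 l : l \in lines A -> mcount (fun=> 1) l = q%:Z.
Proof. by move=> lA; rewrite /mcount sumr_const (ap_order lA) natz. Qed.

Lemma msize1 : msize (fun _ : point A => 1) = #|point A|%:Z.
Proof. by rewrite /msize sumr_const natz. Qed.

(** A line [m] outside [d] meets each line of [d] in exactly one point, and these intersections
    partition the [q] points of [m]. *)
Lemma direction_card d : d \in directions A -> #|d| = q.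
Proof.
move=> dA.
(* Of two nonparallel lines, at least one lies outside [d]. *)
have [m mA md] : exists2 m, m \in lines A & m \notin d.
  have [l lA [m mA not_lm]] := two_lines_meet.
  have [ld|] := boolP (l \in d); last by exists l.
  by exists m; rewrite // (direction_mem dA ld mA).
have lm1 l : l \in d -> #|m :&: l| = 1%N.
  move=> ld; have lA := direction_lines dA ld.
  have := direction_mem dA ld mA; rewrite (negPf md) => /esym/negbT.
  rewrite negb_or => /andP[neq_lm /pred0Pn[x /andP[/= xl xm]]].
  apply/eqP/cards1P; exists x; apply/setP=> y; rewrite !inE.
  apply/andP/eqP=> [[ym yl]|->]; last by split.
  by apply: contraNeq neq_lm => neq_yx; rewrite (line_unique lA mA neq_yx).
have := sum_mcount (mult_of_set m) dA.
rewrite msize_set (ap_order mA) (eq_bigr (fun=> 1)); last first.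
  by move=> l ld; rewrite mcount_set lm1.
by rewrite sumr_const natz; case.
Qed.

(** * Double counting over all lines *)

Lemma sum_lines (F : {set point A} -> int) :
  \sum_(l in lines A) F l = \sum_(d in directions A) \sum_(l in d) F l.
Proof. exact: set_partition_big directions_partition. Qed.

(** One line per direction passes through a single point, and one line joins two distinct points.
    The number of directions stays symbolic, since its value [q + 1] is itself derived from this
    count in [plane_counts]. *)
Lemma join_count x y :
  \sum_(l in lines A) (x \in l)%:Z * (y \in l)%:Z
    = (#|directions A|%:Z - 1) * (x == y)%:Z + 1.
Proof.
have [->|neq_xy] := eqVneq x y.
  rewrite mulr1 subrK sum_lines (eq_bigr (fun=> 1)) ?sumr_const ?natz // => d dA.
  (* The indicator of [y \in l] is the line count of the singleton of [y], so its sum over [d] is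
     the size of that singleton. *)
  transitivity (msize (mult_of_set [set y])); last by rewrite msize_set cards1.
  rewrite -(sum_mcount _ dA); apply: eq_bigr => l _.
  rewrite mcount_set; have [yl|yl] := boolP (y \in l).
    by rewrite (setIidPl _) ?cards1 ?sub1set.
  by rewrite (_ : _ :&: _ = set0) ?cards0 //; apply/eqP; rewrite setI_eq0 disjoints1.
rewrite mulr0 add0r.
have [l [[lA xl yl] _]] := ap_join neq_xy.
rewrite (bigD1 l) //= xl yl mul1r big1 ?addr0 // => m /andP[mA neq_ml].
have [xm|] := boolP (x \in m); last by rewrite mul0r.
have [ym|] := boolP (y \in m); last by rewrite mulr0.
by rewrite (line_unique mA lA neq_xy) ?eqxx in neq_ml.
Qed.

Lemma double_count (muS muT : point A -> int) :
  \sum_(l in lines A) mcount muS l * mcount muT l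
    = (#|directions A|%:Z - 1) * (\sum_x muS x * muT x) + msize muS * msize muT.
Proof.
under eq_bigr do rewrite !mcountE big_distrlr /=.
rewrite exchange_big /= mulr_sumr /msize mulr_suml -big_split /=.
apply: eq_bigr => x _; rewrite exchange_big /=.
under eq_bigr => y _.
  rewrite (eq_bigr (fun l : {set point A} =>
    muS x * muT y * ((x \in l)%:Z * (y \in l)%:Z))); last by move=> l _; ring.
  rewrite -mulr_sumr join_count mulrDr mulr1; over.
rewrite big_split /= -mulr_sumr; congr (_ + _).
(* Only the diagonal term [y = x] carries the factor [#|directions A| - 1]. *)
rewrite (bigD1 x) //= eqxx big1 ?addr0 => [|y neq_yx]; first by rewrite mulr1 mulrC.
by rewrite eq_sym (negPf neq_yx) !mulr0.
Qed.

(** One direction splits the points into [q] lines of [q] points. For the number [r] of directions,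
    [double_count] is applied to the constant 1 and a single point: each direction contributes [q],
    whence [r * q = r - 1 + q ^ 2]. *)
Lemma plane_counts : #|directions A| = q.+1 /\ #|point A| = (q ^ 2)%N.
Proof.
have q_gt1 := order_gt1.
have [l lA _] := two_lines_meet.
have [x xl] : exists x, x \in l by apply/set0Pn/line_nonempty.
have pointE : #|point A|%:Z = q%:Z ^+ 2.
  have [d dA] : exists d, d \in directions A.
    move: lA; rewrite -(cover_partition directions_partition).
    by case/bigcupP=> d dA _; exists d.
  rewrite -msize1 -(sum_mcount _ dA) (eq_bigr (fun=> q%:Z)); last first.
    by move=> m /(direction_lines dA); apply: mcount1.
  by rewrite sumr_const (direction_card dA) -mulr_natr natz.
have := double_count (fun=> 1) (mult_of_set [set x]).
rewrite msize1 msize_set cards1 (eq_bigr (mult_of_set [set x])); last first.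
  by move=> y _; rewrite mul1r.
rewrite -/(msize _) msize_set cards1 pointE !mulr1 sum_lines.
rewrite (eq_bigr (fun=> q%:Z)) => [|d dA]; last first.
  rewrite (eq_bigr (fun m => q%:Z * mcount (mult_of_set [set x]) m)) => [|m md].
    by rewrite -mulr_sumr (sum_mcount _ dA) msize_set cards1 mulr1.
  by rewrite mcount1 ?(direction_lines dA md).
rewrite sumr_const -mulr_natr natz => eq_r; split; last first.
  by apply/eqP; rewrite -eqz_nat pointE -!natz natrX.
(* The relation factors as [(q - 1) * (r - (q + 1)) = 0], and [1 < q] allows cancelling [q - 1]. *)
have q1_neq0 : q%:Z - 1 != 0 by rewrite subr_eq0 eqz_nat gtn_eqF.
apply/eqP; rewrite -eqz_nat -subr_eq0; apply/eqP.
apply: (mulfI q1_neq0); rewrite mulr0 intS.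
by move/eqP: eq_r; rewrite -subr_eq0 => /eqP <-; ring.
Qed.

(** * Equidistribution and the inner product *)

Lemma equidistributed_sum (muS muT : point A -> int) d :
  d \in directions A -> equidistributed muS d ->
  q%:Z * \sum_(l in d) mcount muS l * mcount muT l = msize muS * msize muT.
Proof.
move=> dA /forall_inP eqS; have [m md] := direction_nonempty dA.
(* The common count factors out of the sum, and [q] times it is [msize muS]. *)
have cS l : l \in d -> mcount muS l = mcount muS m.
  by move=> ld; apply/eqP; apply: (forall_inP (eqS l ld)).
rewrite -(sum_mcount muS dA) -(sum_mcount muT dA) (eq_bigr _ cS).
rewrite sumr_const (direction_card dA) -mulr_natr natz.
rewrite (eq_bigr (fun l => mcount muS m * mcount muT l)) => [|l /cS-> //].
by rewrite -mulr_sumr mulrA [q%:Z * _]mulrC.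
Qed.

(** Denominators are cleared so that the whole count stays in the integers. *)
Lemma inner_product (muS muT : point A -> int) :
  (forall d, d \in directions A ->
     equidistributed muS d || equidistributed muT d) ->
  q%:Z ^+ 2 * \sum_x muS x * muT x = msize muS * msize muT.
Proof.
move=> equi; have [dirE _] := plane_counts.
have : q%:Z * \sum_(l in lines A) mcount muS l * mcount muT l
    = msize muS * msize muT * q.+1%:Z.
  rewrite sum_lines mulr_sumr (eq_bigr (fun=> msize muS * msize muT)).
    by rewrite sumr_const dirE -mulr_natr natz.
  move=> d dA; case/orP: (equi d dA) => [eqS|eqT].
    exact: equidistributed_sum.
  under eq_bigr do rewrite mulrC.
  by rewrite equidistributed_sum // mulrC.
(* With [I] the inner product, this reads [q * (q * I + |S||T|) = (q + 1)|S||T|], and [q|S||T|]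
   cancels. *)
rewrite double_count dirE intS => /eqP.
rewrite -subr_eq0 => /eqP eq_sum; apply/eqP; rewrite -subr_eq0; apply/eqP.
by rewrite -[RHS]eq_sum; ring.
Qed.

Lemma not_determined_equidistributed S d : d \in directions A -> #|S| = q ->
  ~~ determines S d -> equidistributed (mult_of_set S) d.
Proof.
move=> dA cardS ndS.
have le1 l : l \in d -> (#|S :&: l| <= 1)%N.
  move=> ld; rewrite leqNgt; apply: contra ndS => /card_gt1P[x [y []]].
  rewrite !inE => /andP[xS xl] /andP[yS yl] neq_xy.
  apply/exists_inP; exists x => //; apply/exists_inP; exists y => //.
  by rewrite neq_xy; apply/exists_inP; exists l; rewrite ?xl.
have sumS : (\sum_(l in d) #|S :&: l| = \sum_(l in d) 1)%N.
  apply/eqP; rewrite sum1_card (direction_card dA) -eqz_nat -[X in _ == X%:Z]cardS -msize_set.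
  rewrite -(sum_mcount _ dA) -natz natr_sum; apply/eqP/eq_bigr => l _.
  by rewrite natz mcount_set.
have eq1 l : l \in d -> #|S :&: l| = 1%N.
  (* The [q] counts are at most 1 and add up to [q], so the equality case of the summed bound makes
     each of them 1. *)
  have /leqif_sum := fun l (ld : l \in d) => leqif_eq (le1 l ld).
  by case=> _; rewrite sumS eqxx => /esym/forall_inP eq1 /eq1/eqP.
by apply/forall_inP=> l ld; apply/forall_inP=> m md; rewrite !mcount_set !eq1.
Qed.

End AffinePlaneCounting.

Theorem theorem1p7 (q : nat) (A : affinePlane q) :
  [/\ (forall muS muT : point A -> int,
        ~ (exists2 d, d \in directions A &
             ~~ equidistributed muS d /\ ~~ equidistributed muT d) ->
        (\sum_(x : point A) muS x * muT x)%:~R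
          = (msize muS)%:~R * (msize muT)%:~R / q%:R ^+ 2 :> rat),
      (forall S T : {set point A},
        ~ (exists2 d, d \in directions A &
             ~~ equidistributed (mult_of_set S) d
             /\ ~~ equidistributed (mult_of_set T) d) ->
        #|S :&: T|%:R = #|S|%:R * #|T|%:R / q%:R ^+ 2 :> rat)
    & (forall S T : {set point A},
        #|S| = q -> #|T| = q -> [disjoint S & T] ->
        exists2 d, d \in directions A & determines S d /\ determines T d)].
Proof.
have q_gt0 : (0 < q)%N by rewrite ltnW ?(order_gt1 A).
have q2_neq0 : q%:R ^+ 2 != 0 :> rat by rewrite expf_neq0 ?pnatr_eq0 -?lt0n.
have general (muS muT : point A -> int) :
    ~ (exists2 d, d \in directions A &
         ~~ equidistributed muS d /\ ~~ equidistributed muT d) ->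
    (\sum_(x : point A) muS x * muT x)%:~R
      = (msize muS)%:~R * (msize muT)%:~R / q%:R ^+ 2 :> rat.
  move=> noineq; apply: (mulIf q2_neq0); rewrite divfK // -intrM.
  rewrite -(@inner_product q A muS muT) => [|d dA].
    by rewrite intrM rmorphXn /= mulrC.
  apply/negPn/negP; rewrite negb_or => /andP[nS nT].
  by apply: noineq; exists d.
have sets (S T : {set point A}) :
    ~ (exists2 d, d \in directions A & ~~ equidistributed (mult_of_set S) d
         /\ ~~ equidistributed (mult_of_set T) d) ->
    #|S :&: T|%:R = #|S|%:R * #|T|%:R / q%:R ^+ 2 :> rat.
  move=> /general; rewrite !msize_set => <-.
  (* The product of two indicators is the indicator of the intersection. *)
  rewrite (eq_bigr (mult_of_set (S :&: T))) => [|x _].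
    by rewrite -/(msize _) msize_set.
  by rewrite /mult_of_set inE; case: (x \in S); case: (x \in T).
split=> // S T cardS cardT dis_ST.
have [/exists_inP[d dA /andP[dS dT]]|] :=
    boolP [exists d in directions A, determines S d && determines T d].
  by exists d.
rewrite negb_exists_in => /forall_inP ndet.
(* If no direction is determined by both sets, each direction has one of them equidistributed, and
   the formula gives [0 = q * q / q ^ 2 = 1]. *)
have := sets S T; rewrite cardS cardT (disjoint_setI0 dis_ST) cards0 => contra.
have : 0 = q%:R * q%:R / q%:R ^+ 2 :> rat.
  apply: contra => -[d dA [nS nT]]; have := ndet d dA.
  rewrite negb_and => /orP[] nd; [case/negP: nS | case/negP: nT];
    exact: not_determined_equidistributed.
by rewrite -expr2 divff // => /eqP.
Qed.
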